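(* Let $H_1,H_2,K_1,K_2$ be Hilbert spaces, let $T$ be a closed linear relation from $H_1$ into $K_1$ and $S$ a closed linear relation from $H_2$ into $K_2$, and suppose both $T$ and $S$ are Hyers-Ulam stable. Then the linear relation $T\times S$ from $H_1\times H_2$ into $K_1\times K_2$ is also Hyers-Ulam stable.
   Context: All Hilbert spaces are real or complex (over the same field), and $H_1\times H_2$, $K_1\times K_2$ carry the usual product Hilbert space structure. A linear relation $T$ from $H$ into $K$ is a linear subspace of $H\times K$ (elements written $\{h,k\}$); it is closed if it is a closed subspace. $R(T)=\{k:\{h,k\}\in T \text{ for some } h\}$. The product of $T$ and $S$ is $$T\times S=\{\{(h_1,h_2),(k_1,k_2)\}:\{h_1,k_1\}\in T \text{ and } \{h_2,k_2\}\in S\}.$$ A linear relation $T$ between normed linear spaces is Hyers-Ulam stable if there is a constant $M\ge 0$ such that for any $y\in R(T)$, $\varepsilon\ge 0$ and $y_0\in R(T)$ with $\|y-y_0\|\le\varepsilon$, there exist $\{x,y\}\in T$ and $\{x_0,y_0\}\in T$ such that $\|x-x_0\|\le M\varepsilon$. *)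

(* Defs.v *)
From Stdlib Require Import Reals Lra.
From Coquelicot Require Import Coquelicot.

Set Implicit Arguments.
Unset Strict Implicit.
Unset Printing Implicit Defensive.

Open Scope R_scope.

Variant scalar_kind := RealScalars | ComplexScalars.

Definition scalar (k : scalar_kind) : AbsRing :=
  match k with RealScalars => R_AbsRing | ComplexScalars => C_AbsRing end.

Definition scalar_conj (k : scalar_kind) : scalar k -> scalar k :=
  match k return scalar k -> scalar k with
  | RealScalars => fun x : R => x
  | ComplexScalars => fun z : C => Cconj z
  end.

Definition scalar_of_R (k : scalar_kind) : R -> scalar k :=
  match k return R -> scalar k with
  | RealScalars => fun x : R => x
  | ComplexScalars => fun x : R => RtoC x
  end.

Lemma scalar_conj_plus (k : scalar_kind) (a b : scalar k) :
  scalar_conj (plus a b) = plus (scalar_conj a) (scalar_conj b).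
Proof. destruct k; [reflexivity | exact (Cplus_conj a b)]. Qed.

Lemma scalar_of_R_plus (k : scalar_kind) (a b : R) :
  scalar_of_R k (a + b) = plus (scalar_of_R k a) (scalar_of_R k b).
Proof. destruct k; [reflexivity | exact (RtoC_plus a b)]. Qed.

(* Linear in the first variable.  Positive definiteness follows from
   [inner_norm] and the separation property of the norm. *)
Record HilbertSpace (k : scalar_kind) := {
  hilbert_space :> CompleteNormedModule (scalar k);
  inner : hilbert_space -> hilbert_space -> scalar k;
  inner_plus_l : forall x y z : hilbert_space,
    inner (plus x y) z = plus (inner x z) (inner y z);
  inner_scal_l : forall (a : scalar k) (x y : hilbert_space),
    inner (scal a x) y = mult a (inner x y);
  inner_conj : forall x y : hilbert_space,
    inner y x = scalar_conj (inner x y);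
  inner_norm : forall x : hilbert_space,
    inner x x = scalar_of_R k (norm x ^ 2)
}.

(* Coquelicot's norm on a product is sqrt (|x1|^2 + |x2|^2), so only
   completeness and the inner product have to be supplied. *)
Section HilbertProduct.

Variables (k : scalar_kind) (H1 H2 : HilbertSpace k).

Definition prod_lim (F : (H1 * H2 -> Prop) -> Prop) : H1 * H2 :=
  (lim (filtermap fst F), lim (filtermap snd F)).

Lemma prod_lim_cauchy (F : (H1 * H2 -> Prop) -> Prop) :
  ProperFilter F -> cauchy (T := prod_UniformSpace H1 H2) F ->
  forall eps : posreal, F (ball (prod_lim F : prod_UniformSpace H1 H2) eps).
Proof.
intros FF cF eps.
assert (c1 : cauchy (filtermap fst F)).
{ intro e; destruct (cF e) as [x Fx]; exists (fst x).
  unfold filtermap; revert Fx; apply filter_imp; intros y Hy; exact (proj1 Hy). }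
assert (c2 : cauchy (filtermap snd F)).
{ intro e; destruct (cF e) as [x Fx]; exists (snd x).
  unfold filtermap; revert Fx; apply filter_imp; intros y Hy; exact (proj2 Hy). }
pose proof (complete_cauchy (filtermap fst F) (filtermap_proper_filter _ _ _ F FF) c1 eps) as b1.
pose proof (complete_cauchy (filtermap snd F) (filtermap_proper_filter _ _ _ F FF) c2 eps) as b2.
unfold filtermap in b1, b2; generalize (filter_and _ _ b1 b2).
apply filter_imp; intros y Hy; exact Hy.
Qed.

Lemma prod_lim_close (F1 F2 : (H1 * H2 -> Prop) -> Prop) :
  filter_le F1 F2 -> filter_le F2 F1 ->
  close (prod_lim F1 : prod_UniformSpace H1 H2) (prod_lim F2).
Proof.
intros le12 le21 eps; split.
- apply (close_lim (filtermap fst F1) (filtermap fst F2));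
    intros P HP; [apply le12 | apply le21]; exact HP.
- apply (close_lim (filtermap snd F1) (filtermap snd F2));
    intros P HP; [apply le12 | apply le21]; exact HP.
Qed.

Definition prod_CompleteNormedModule : CompleteNormedModule (scalar k) :=
  CompleteNormedModule.Pack (scalar k) (H1 * H2)
    (CompleteNormedModule.Class (scalar k) (H1 * H2)
      (NormedModule.class _ (prod_NormedModule (scalar k) H1 H2))
      (CompleteSpace.Mixin (prod_UniformSpace H1 H2) prod_lim
        prod_lim_cauchy prod_lim_close))
    (H1 * H2).

Definition prod_inner (x y : prod_CompleteNormedModule) : scalar k :=
  plus (inner (fst x) (fst y)) (inner (snd x) (snd y)).

Lemma prod_inner_plus_l (x y z : prod_CompleteNormedModule) :
  prod_inner (plus x y) z = plus (prod_inner x z) (prod_inner y z).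
Proof.
unfold prod_inner; simpl; rewrite !inner_plus_l, <- !plus_assoc; f_equal.
rewrite !plus_assoc; f_equal; apply plus_comm.
Qed.

Lemma prod_inner_scal_l (a : scalar k) (x y : prod_CompleteNormedModule) :
  prod_inner (scal a x) y = mult a (prod_inner x y).
Proof.
unfold prod_inner; simpl; rewrite !inner_scal_l; symmetry; exact (mult_distr_l (K := scalar k) _ _ _).
Qed.

Lemma prod_inner_conj (x y : prod_CompleteNormedModule) :
  prod_inner y x = scalar_conj (prod_inner x y).
Proof.
unfold prod_inner; rewrite scalar_conj_plus, <- !inner_conj; reflexivity.
Qed.

Lemma prod_inner_norm (x : prod_CompleteNormedModule) :
  prod_inner x x = scalar_of_R k (norm x ^ 2).
Proof.
unfold prod_inner; rewrite !inner_norm, <- scalar_of_R_plus; f_equal.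
symmetry; apply pow2_sqrt, Rplus_le_le_0_compat; apply pow2_ge_0.
Qed.

Definition prod_HilbertSpace : HilbertSpace k :=
  {| hilbert_space := prod_CompleteNormedModule;
     inner := prod_inner;
     inner_plus_l := prod_inner_plus_l;
     inner_scal_l := prod_inner_scal_l;
     inner_conj := prod_inner_conj;
     inner_norm := prod_inner_norm |}.

End HilbertProduct.

Arguments prod_HilbertSpace {k} H1 H2.

Record linear_relation (K : AbsRing) (V W : NormedModule K) := {
  graph :> prod_NormedModule K V W -> Prop;
  graph_zero : graph zero;
  graph_plus : forall p q : prod_NormedModule K V W,
    graph p -> graph q -> graph (plus p q);
  graph_scal : forall (a : K) (p : prod_NormedModule K V W),
    graph p -> graph (scal a p)
}.

Arguments linear_relation {K} V W.

Definition closed_relation (K : AbsRing) (V W : NormedModule K)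
    (T : linear_relation V W) : Prop :=
  closed (T : prod_NormedModule K V W -> Prop).

Definition range (K : AbsRing) (V W : NormedModule K)
    (T : linear_relation V W) (y : W) : Prop :=
  exists x : V, T (x, y).

Definition hyers_ulam_stable (K : AbsRing) (V W : NormedModule K)
    (T : linear_relation V W) : Prop :=
  exists M : R, 0 <= M /\
    forall (y : W) (eps : R) (y0 : W),
      range T y -> 0 <= eps -> range T y0 -> norm (minus y y0) <= eps ->
      exists x x0 : V,
        T (x, y) /\ T (x0, y0) /\ norm (minus x x0) <= M * eps.

Section RelationProduct.

Variables (k : scalar_kind) (H1 H2 K1 K2 : HilbertSpace k).
Variables (T : linear_relation H1 K1) (S : linear_relation H2 K2).

Let ambient : NormedModule (scalar k) :=
  prod_NormedModule (scalar k) (prod_HilbertSpace H1 H2) (prod_HilbertSpace K1 K2).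

Definition prod_graph (p : ambient) : Prop :=
  T (fst (fst p), fst (snd p)) /\ S (snd (fst p), snd (snd p)).

Lemma prod_graph_zero : prod_graph zero.
Proof. split; [exact (graph_zero T) | exact (graph_zero S)]. Qed.

Lemma prod_graph_plus (p q : ambient) :
  prod_graph p -> prod_graph q -> prod_graph (plus p q).
Proof.
intros [p1 p2] [q1 q2].
split; [exact (graph_plus p1 q1) | exact (graph_plus p2 q2)].
Qed.

Lemma prod_graph_scal (a : scalar k) (p : ambient) :
  prod_graph p -> prod_graph (scal a p).
Proof.
intros [p1 p2]; split; [exact (graph_scal a p1) | exact (graph_scal a p2)].
Qed.

Definition prod_relation :
    linear_relation (prod_HilbertSpace H1 H2) (prod_HilbertSpace K1 K2) :=
  {| graph := prod_graph;
     graph_zero := prod_graph_zero;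
     graph_plus := prod_graph_plus;
     graph_scal := prod_graph_scal |}.

End RelationProduct.

(* Main.v *)
Require Import Defs.
From Stdlib Require Import Reals.
From Coquelicot Require Import Coquelicot.
From Stdlib Require Import Lra.

(** Each component of a vector in the product has norm at most that of the
    vector, so stability applies to the two components separately, with the
    same [eps].  The bounds [M1 * eps] and [M2 * eps] then combine because the
    Euclidean norm of a pair is at most the sum of the norms of its
    components; [M1 + M2] is therefore a constant for the product. *)

Section ProductNorm.

Variables (K : AbsRing) (V W : NormedModule K).

Lemma norm_fst_le (p : prod_NormedModule K V W) : norm (fst p) <= norm p.
Proof.
(* The left half of [sqrt_plus_sqr] bounds the larger absolute value by the Euclidean norm. *)
refine (Rle_trans _ _ _ _ (proj1 (sqrt_plus_sqr (norm (fst p)) (norm (snd p))))).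
rewrite <- (Rabs_pos_eq (norm (fst p))) at 1 by apply norm_ge_0.
apply Rmax_l.
Qed.

Lemma norm_snd_le (p : prod_NormedModule K V W) : norm (snd p) <= norm p.
Proof.
refine (Rle_trans _ _ _ _ (proj1 (sqrt_plus_sqr (norm (fst p)) (norm (snd p))))).
rewrite <- (Rabs_pos_eq (norm (snd p))) at 1 by apply norm_ge_0.
apply Rmax_r.
Qed.

Lemma norm_prod_le (p : prod_NormedModule K V W) :
  norm p <= norm (fst p) + norm (snd p).
Proof.
pose proof (norm_ge_0 (fst p)) as h1; pose proof (norm_ge_0 (snd p)) as h2.
change (sqrt (norm (fst p) ^ 2 + norm (snd p) ^ 2) <= norm (fst p) + norm (snd p)).
rewrite <- (sqrt_pow2 (norm (fst p) + norm (snd p))) by lra.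
(* The squares differ by the cross term, twice a product of norms. *)
apply sqrt_le_1_alt; nra.
Qed.

End ProductNorm.

Theorem theorem3p19 (k : scalar_kind) (H1 H2 K1 K2 : HilbertSpace k)
    (T : linear_relation H1 K1) (S : linear_relation H2 K2)
    (hT : closed_relation T) (hS : closed_relation S)
    (hTstable : hyers_ulam_stable T) (hSstable : hyers_ulam_stable S) :
  hyers_ulam_stable (prod_relation T S).
Proof.
destruct hTstable as [M1 [hM1 stT]], hSstable as [M2 [hM2 stS]].
exists (M1 + M2); split; [lra |].
intros y eps y0 [u [uT uS]] heps [u0 [u0T u0S]] hy.
(* The components of [u] and [u0] witness range membership; stability supplies new preimages. *)
destruct (stT (fst y) eps (fst y0)) as [x1 [z1 [hx1 [hz1 d1]]]];
  [exists (fst u); exact uT | exact heps | exists (fst u0); exact u0T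
  | exact (Rle_trans _ _ _ (norm_fst_le _ K1 K2 (minus y y0)) hy) |].
destruct (stS (snd y) eps (snd y0)) as [x2 [z2 [hx2 [hz2 d2]]]];
  [exists (snd u); exact uS | exact heps | exists (snd u0); exact u0S
  | exact (Rle_trans _ _ _ (norm_snd_le _ K1 K2 (minus y y0)) hy) |].
exists (x1, x2), (z1, z2); split; [| split].
- split; [exact hx1 | exact hx2].
- split; [exact hz1 | exact hz2].
(* Subtraction in the product is componentwise, up to conversion. *)
- refine (Rle_trans _ _ _ (norm_prod_le _ H1 H2 (minus x1 z1, minus x2 z2)) _).
  rewrite Rmult_plus_distr_r.
  exact (Rplus_le_compat _ _ _ _ d1 d2).
Qed.
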